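(* Let $C_\phi$ be a composition operator on a directed graph with one circuit, with data $\kappa\in\mathbb N$, $\eta\in\mathbb N\cup\{\infty\}$, $(X,\mathscr A,\mu)$, $\phi$ as in the context. Let $m\ge 2$ be an integer and suppose $C_\phi\in\boldsymbol B(L^2(\mu))$. Then the following conditions are equivalent: (i) $C_\phi$ is an $m$-isometry; (ii) $\mu(x_{i,j+1})$ is a polynomial in $j$ of degree at most $m-2$ for every $i\in J_{[1,\eta]}$, and for every $r\in\{1,\ldots,\kappa\}$, $$\sum_{p=0}^{m}(-1)^p\binom{m}{p}\Big(\mu(x_{\Phi_2(p+r)})+\sum_{i=1}^{\eta}\ \sum_{l=0}^{\Phi_1(p+r)-1}\mu(x_{i,\,l\kappa+\Phi_2(p+r)})\Big)=0.$$
   Context: Setting. $\mathbb N=\{1,2,\ldots\}$, $\mathbb Z_+=\{0,1,2,\ldots\}$. Let $\kappa\in\mathbb N$, $\eta\in\mathbb N\cup\{\infty\}$, $J_{[1,\eta]}=\{i\in\mathbb N: i\le\eta\}$ (so $J_{[1,\infty]}=\mathbb N$), and let $X=\{x_1,\ldots,x_\kappa\}\cup\{x_{i,j}: i\in J_{[1,\eta]},\, j\in\mathbb N\}$, all the listed points being distinct. Let $\mathscr A$ be the $\sigma$-algebra of all subsets of $X$ and $\mu$ a positive measure on $\mathscr A$ with $\mu(x):=\mu(\{x\})\in(0,\infty)$ for all $x\in X$. Define $\phi\colon X\to X$ by $\phi(x_{i,j})=x_{i,j-1}$ for $j\ge2$, $\phi(x_{i,1})=x_\kappa$, $\phi(x_1)=x_\kappa$,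 and $\phi(x_i)=x_{i-1}$ for $2\le i\le\kappa$. The operator $C_\phi f=f\circ\phi$ in the complex space $L^2(\mu)=L^2(X,\mathscr A,\mu)$ is called a composition operator on a directed graph with one circuit. $C_\phi\in\boldsymbol B(L^2(\mu))$ means that $C_\phi$ is everywhere defined and bounded on $L^2(\mu)$. A bounded operator $T$ on a Hilbert space is an $m$-isometry if $\sum_{k=0}^m(-1)^k\binom mk T^{*k}T^k=0$. A real sequence $\{\gamma_n\}_{n=0}^\infty$ is said to be a polynomial in $n$ of degree at most $k$ if there is a real polynomial $p$ of degree at most $k$ with $p(n)=\gamma_n$ for all $n\in\mathbb Z_+$. The functions $\Phi_1\colon\mathbb Z\to\mathbb Z$ and $\Phi_2\colon\mathbb Z\to\{1,\ldots,\kappa\}$ are uniquely determined by $n=\Phi_1(n)\kappa+\Phi_2(n)$, $n\in\mathbb Z$. Empty sums are $0$. *)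

(* Defs.v *)
From HB Require Import structures.
From mathcomp Require Import all_boot all_order all_algebra.
From mathcomp Require Import complex.
From mathcomp Require Import all_classical all_reals all_analysis measurable_realfun.
From mathcomp Require Import ring.

Set Implicit Arguments.
Unset Strict Implicit.
Unset Printing Implicit Defensive.
Import Order.TTheory GRing.Theory Num.Theory.
Import numFieldNormedType.Exports.
Local Open Scope classical_set_scope.
Local Open Scope ring_scope.

Local Notation Re := complex.Re.
Local Notation Im := complex.Im.

Section Operators.
Variables (C : numClosedFieldType) (V : lmodType C).
Variable dot : {dot V for (@Num.conj C)}.
Implicit Types (T S : V -> V) (u v : V).

Definition hnorm u : C := sqrtC (dot u u).

Definition bounded_operator T := exists c : C, forall u, hnorm (T u) <= c * hnorm u.

Definition is_adjoint T S := forall u v, dot (T u) v = dot u (S v).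

(* Since [dot] is positive definite, T has at most one adjoint T* = S; a
   bounded operator on a Hilbert space has one. *)
Definition m_isometry (m : nat) T := exists2 S, is_adjoint T S &
  forall u, \sum_(0 <= k < m.+1) ((-1) ^+ k * 'C(m, k)%:R) *: iter k S (iter k T u) = 0.

Lemma adjoint_unique T S S' : is_adjoint T S -> is_adjoint T S' -> S =1 S'.
Proof.
move=> aS aS' v; apply/eqP; rewrite -subr_eq0; apply/negPn/negP => n0.
have : 0 < dot _ _ := neq0_dnorm_gt0 _ n0.
by rewrite linearBr /= -aS -aS' subrr ltxx.
Qed.

End Operators.

Section L2.
Context d (X : measurableType d) (R : realType).
Implicit Types (mu : {measure set X -> \bar R}) (f g : X -> R[i]).

Definition pointwise_measure mu :=
  (forall A : set X, measurable A) /\ (forall x, (0 < mu [set x] < +oo)%E).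

Definition L2 mu : {pred X -> R[i]} := mem [set f : X -> R[i] |
  [/\ measurable_fun setT (fun x => Re (f x)),
      measurable_fun setT (fun x => Im (f x)) &
      (\int[mu]_x ((Normc.normc (f x)) ^+ 2)%:E < +oo)%E]].

Lemma normc2E (z : R[i]) : Normc.normc z ^+ 2 = Re z ^+ 2 + Im z ^+ 2.
Proof. by case: z => a b /=; rewrite sqr_sqrtr// addr_ge0// sqr_ge0. Qed.

Lemma Lfun2P mu (f : X -> R) : f \in Lfun mu 2%:E <->
  measurable_fun setT f /\ (\int[mu]_x ((f x) ^+ 2)%:E < +oo)%E.
Proof.
split=> [fL|[mf fi]].
  split; first by move: fL; rewrite inE => /andP[/[!inE]].
  have /integrableP[_] := Lfun2_integrable_sqr fL.
  by under eq_integral => x _ do rewrite gee0_abs/= ?lee_fin ?sqr_ge0//.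
rewrite inE; apply/andP; split; first by rewrite inE.
rewrite inE/= /finite_norm unlock poweR_lty//.
by under eq_integral => x _ do rewrite /= powR_mulrn// real_normK ?num_real//.
Qed.

Lemma L2P mu f : f \in L2 mu <->
  (fun x => Re (f x)) \in Lfun mu 2%:E /\ (fun x => Im (f x)) \in Lfun mu 2%:E.
Proof.
have m2 (h : X -> R) : measurable_fun setT h ->
    measurable_fun setT (fun x => (h x ^+ 2)%:E).
  by move=> mh; apply/measurable_EFinP; exact: measurable_funX.
have D : measurable_fun setT (fun x => Re (f x)) ->
    measurable_fun setT (fun x => Im (f x)) ->
    (\int[mu]_x ((Normc.normc (f x)) ^+ 2)%:E =
     \int[mu]_x ((Re (f x)) ^+ 2)%:E + \int[mu]_x ((Im (f x)) ^+ 2)%:E)%E.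
  move=> mr mi; under eq_integral do rewrite normc2E EFinD.
  apply: ge0_integralD => //.
  - by move=> x _; rewrite lee_fin sqr_ge0.
  - exact: (m2 (fun x => Re (f x))).
  - by move=> x _; rewrite lee_fin sqr_ge0.
  - exact: (m2 (fun x => Im (f x))).
split.
  rewrite inE/= => -[mr mi]; rewrite D// => lty.
  split; apply/Lfun2P; split=> //; apply: le_lt_trans lty.
    by rewrite leeDl// integral_ge0// => x _; rewrite lee_fin sqr_ge0.
  by rewrite leeDr// integral_ge0// => x _; rewrite lee_fin sqr_ge0.
move=> [/Lfun2P[mr ir] /Lfun2P[mi ii]]; rewrite inE/=; split=> //.
by rewrite D//; exact: lte_add_pinfty.
Qed.

Lemma L2_submod_closed mu : submod_closed (L2 mu).
Proof.
have p1 : (1 <= 2%:E :> \bar R)%E by rewrite lee_fin ler1n.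
pose cl := (Lfun_submod_closed mu p1).
split.
  by apply/L2P; split=> /=; exact: cl.1.
move=> a f g /L2P[fr fi] /L2P[gr gi]; apply/L2P.
have s b h : h \in Lfun mu 2%:E -> b *: h \in Lfun mu 2%:E.
  by move=> hL; rewrite -[b *: h]addr0; apply: cl.2 => //; exact: cl.1.
split.
  rewrite (_ : (fun x => _) = Re a *: (fun x => Re (f x)) +
     ((- Im a) *: (fun x => Im (f x)) + (fun x => Re (g x)))).
    by apply: cl.2 => //; exact: cl.2.
  apply/funext => x; rewrite !fctE /=.
  case: a (f x) (g x) => [a b] [u v] [w z] /=.
  by rewrite -[_ *: u]/(a * u) -[_ *: v]/(- b * v) mulNr addrA.
rewrite (_ : (fun x => _) = Re a *: (fun x => Im (f x)) +
     (Im a *: (fun x => Re (f x)) + (fun x => Im (g x)))).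
  by apply: cl.2 => //; exact: cl.2.
apply/funext => x; rewrite !fctE /=.
case: a (f x) (g x) => [a b] [u v] [w z] /=.
by rewrite -[_ *: v]/(a * v) -[_ *: u]/(b * u) addrA.
Qed.

HB.instance Definition _ mu := GRing.isSubmodClosed.Build R[i] (X -> R[i]) (L2 mu)
  (L2_submod_closed mu).

(* As every singleton has positive measure, functions that agree almost
   everywhere are equal (see [ae_eq_eq]), so no quotient is needed. *)
Record L2type mu (hmu : pointwise_measure mu) :=
  MkL2 { L2val :> X -> R[i]; L2valP : L2val \in L2 mu }.

Section Space.
Variables (mu : {measure set X -> \bar R}) (hmu : pointwise_measure mu).

HB.instance Definition _ := [isSub of L2type hmu for (@L2val mu hmu)].
HB.instance Definition _ := [Choice of L2type hmu by <:].
HB.instance Definition _ := [SubChoice_isSubLmodule of L2type hmu by <:].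

Lemma ae_eq_eq T (f g : X -> T) : {ae mu, forall x, f x = g x} -> f = g.
Proof.
move=> [N [mN N0 sN]]; apply/funext => x; apply: contrapT => fgx.
have := hmu.2 x => /andP[+ _]; rewrite ltNge => /negP; apply.
by rewrite -N0 le_measure// ?inE//; [exact: hmu.1|move=> _ ->; exact: sN].
Qed.

Definition cintegral (f : X -> R[i]) : R[i] :=
  Complex (\int[mu]_x Re (f x)) (\int[mu]_x Im (f x)).

Definition L2dot (f g : L2type hmu) : R[i] := cintegral (fun x => f x * (g x)^*).

Let cintegrable (f : X -> R[i]) :=
  mu.-integrable setT (fun x => (Re (f x))%:E) /\
  mu.-integrable setT (fun x => (Im (f x))%:E).

Let cintegrable_dot (f g : L2type hmu) : cintegrable (fun x => f x * (g x)^*).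
Proof.
have [/L2P[fr fi] /L2P[gr gi]] := (L2valP f, L2valP g).
have I (h k : X -> R) : h \in Lfun mu 2%:E -> k \in Lfun mu 2%:E ->
    mu.-integrable setT (fun x => (h x * k x)%:E).
  by move=> hL kL; apply/Lfun1_integrable; exact: Lfun2_mul_Lfun1.
split.
  rewrite (_ : (fun x => _) = (fun x => (Re (f x) * Re (g x))%:E) \+
    (fun x => (Im (f x) * Im (g x))%:E))%E; last first.
    apply/funext => x /=; rewrite -EFinD; congr _%:E.
    by case: (f x) (g x) => [? ?] [? ?] /=; rewrite mulrN opprK.
  by apply: integrableD => //; exact: I.
rewrite (_ : (fun x => _) = (fun x => (Im (f x) * Re (g x))%:E) \-
    (fun x => (Re (f x) * Im (g x))%:E))%E; last first.
  apply/funext => x /=; rewrite -EFinB; congr _%:E.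
  by case: (f x) (g x) => [? ?] [? ?] /=; rewrite mulrN addrC.
by apply: integrableB => //; exact: I.
Qed.

Let cintegralD f g : cintegrable f -> cintegrable g ->
  cintegral (fun x => f x + g x) = cintegral f + cintegral g.
Proof.
move=> [fr fi] [gr gi]; rewrite /cintegral.
under eq_Rintegral do rewrite raddfD.
under [in X in Complex _ X]eq_Rintegral do rewrite raddfD.
by rewrite !RintegralD.
Qed.

Let cintegralZ a f : cintegrable f ->
  cintegral (fun x => a * f x) = a * cintegral f.
Proof.
move=> [fr fi]; rewrite /cintegral; case: a => a b.
have Z c (h : X -> R) : mu.-integrable setT (fun x => (h x)%:E) ->
    mu.-integrable setT (fun x => (c * h x)%:E).
  by move=> ih; exact: (integrableZl measurableT c ih).
rewrite (@eq_Rintegral _ _ _ _ _ (fun x => a * Re (f x) - b * Im (f x))); last first.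
  by move=> x _; case: (f x).
rewrite [X in Complex _ X](@eq_Rintegral _ _ _ _ _
  (fun x => a * Im (f x) + b * Re (f x))); last by move=> x _; case: (f x).
rewrite (RintegralB measurableT (Z a _ fr) (Z b _ fi)).
rewrite (RintegralD measurableT (Z a _ fi) (Z b _ fr)).
by rewrite !RintegralZl.
Qed.

Let L2dotC (f g : L2type hmu) : L2dot f g = (-1) ^+ false * (L2dot g f)^*.
Proof.
rewrite expr0 mul1r /L2dot /cintegral.
have [_ fi] := cintegrable_dot g f.
congr Complex; first by apply: eq_Rintegral => x _; case: (f x) (g x) =>
  [? ?] [? ?] /=; rewrite !mulrN !opprK mulrC [X in _ + X]mulrC.
rewrite -mulN1r -RintegralZl//; apply: eq_Rintegral => x _.
by case: (f x) (g x) => [? ?] [? ?] /=; rewrite mulN1r !mulrN opprD opprK addrC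
  mulrC [X in _ - X]mulrC.
Qed.

Let L2dotl (h : L2type hmu) : GRing.linear_for *%R (L2dot ^~ h).
Proof.
move=> a f g; rewrite /L2dot.
have [fh gh] := (cintegrable_dot f h, cintegrable_dot g h).
rewrite -cintegralZ// -cintegralD//.
  by congr cintegral; apply/funext => x /=; rewrite mulrA -mulrDl.
rewrite (_ : (fun x => _) = (fun x => (a *: f) x * (h x)^*)).
  exact: cintegrable_dot.
by apply/funext => x; exact: mulrA.
Qed.

Let L2dotr (h : L2type hmu) : GRing.linear_for (Num.conj \; *%R) (L2dot h).
Proof.
move=> a f g; rewrite L2dotC L2dotl expr0 mul1r rmorphD rmorphM /=.
by rewrite [L2dot h f]L2dotC [L2dot h g]L2dotC !mul1r.
Qed.

HB.instance Definition _ := bilinear_isBilinear.Build R[i] (L2type hmu)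
  (L2type hmu) R[i] *%R (Num.conj \; *%R) L2dot (L2dotl, L2dotr).

HB.instance Definition _ := isHermitianSesquilinear.Build R[i] (L2type hmu)
  false Num.conj L2dot L2dotC.

Let L2dot_gt0 (f : L2type hmu) : f != 0 -> 0 < L2dot f f.
Proof.
move=> f0.
have mf h : measurable_fun setT (h : X -> R) by move=> _ Y _; exact: hmu.1.
have E : L2dot f f = (\int[mu]_x (Normc.normc (f x) ^+ 2))%:C%C.
  congr Complex.
    by apply: eq_Rintegral => x _; rewrite normc2E; case: (f x) => a b /=;
      rewrite mulrN opprK !expr2.
  transitivity (\int[mu]_(x in setT) (0 : R)); last by rewrite Rintegral_cst// mul0r.
  by apply: eq_Rintegral => x _; case: (f x) => a b /=; rewrite mulrN addrC mulrC subrr.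
rewrite E ltcR.
have [_ _ flty] : [/\ measurable_fun setT (fun x => Re (f x)),
    measurable_fun setT (fun x => Im (f x)) &
    (\int[mu]_x (Normc.normc (f x) ^+ 2)%:E < +oo)%E].
  by have := L2valP f; rewrite inE.
have ge0 : (0 <= \int[mu]_x (Normc.normc (f x) ^+ 2)%:E)%E.
  by apply: integral_ge0 => x _; rewrite lee_fin sqr_ge0.
apply: fine_gt0; rewrite flty andbT lt_def ge0 andbT.
apply: contra f0 => /eqP f0; apply/eqP/val_inj => /=.
apply: ae_eq_eq; have m2 : measurable_fun setT (fun x => (Normc.normc (f x) ^+ 2)%:E).
  by apply/measurable_EFinP; exact: mf.
have : (\int[mu]_x `|(Normc.normc (f x) ^+ 2)%:E|)%E = 0%E.
  by rewrite -f0; apply: eq_integral => x _; rewrite gee0_abs// lee_fin sqr_ge0.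
move/(ae_eq_integral_abs mu measurableT m2); apply: filterS => x /(_ I) [].
by move/eqP; rewrite sqrf_eq0 => /eqP/Normc.eq0_normc.
Qed.

HB.instance Definition _ := isDotProduct.Build R[i] (L2type hmu) L2dot L2dot_gt0.

Definition comp_op (phi : X -> X) (hphi : forall f, f \in L2 mu -> f \o phi \in L2 mu)
  (f : L2type hmu) : L2type hmu := MkL2 hmu (hphi f (L2valP f)).

End Space.
End L2.

Arguments L2dot {d X R mu} hmu f g.
Arguments comp_op {d X R mu} hmu {phi} hphi f.

(* J_[1,eta], with None standing for eta = oo. *)
Definition J (eta : option nat) : pred nat :=
  [pred i | (1 <= i)%N && (if eta is Some n then (i <= n)%N else true)].

(* The values of x outside J_[1,kappa], and of xb at i outside J_[1,eta] or
   j = 0, are junk. *)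
Record one_circuit (X : Type) (kappa : nat) (eta : option nat)
    (x : nat -> X) (xb : nat -> nat -> X) (phi : X -> X) : Prop := OneCircuit {
  kappa_gt0 : (0 < kappa)%N;
  eta_gt0 : if eta is Some n then (0 < n)%N else true;
  x_inj : {in J (Some kappa) &, injective x};
  xb_inj : forall i i' j j', i \in J eta -> i' \in J eta ->
    (1 <= j)%N -> (1 <= j')%N -> xb i j = xb i' j' -> i = i' /\ j = j';
  x_neq_xb : forall r i j, r \in J (Some kappa) -> i \in J eta -> (1 <= j)%N ->
    x r <> xb i j;
  x_cover : forall z, (exists2 r, r \in J (Some kappa) & z = x r) \/
    (exists i j, [/\ i \in J eta, (1 <= j)%N & z = xb i j]);
  phi_xbS : forall i j, i \in J eta -> (2 <= j)%N -> phi (xb i j) = xb i j.-1;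
  phi_xb1 : forall i, i \in J eta -> phi (xb i 1%N) = x kappa;
  phi_x1 : phi (x 1%N) = x kappa;
  phi_xS : forall i, (2 <= i <= kappa)%N -> phi (x i) = x i.-1
}.

Definition polynomial_seq (R : nzRingType) (k : nat) (g : nat -> R) :=
  exists2 p : {poly R}, (size p <= k.+1)%N & forall n, p.[n%:R] = g n.

Definition Phi1 (kappa : nat) (n : int) : int := ((n - 1) %/ kappa%:Z)%Z.
Definition Phi2 (kappa : nat) (n : int) : nat := `|((n - 1) %% kappa%:Z)%Z|.+1.

Lemma PhiP (kappa : nat) (n q : int) (r : nat) : (0 < kappa)%N ->
  (1 <= r <= kappa)%N /\ n = q * kappa%:Z + r%:Z <->
  q = Phi1 kappa n /\ r = Phi2 kappa n.
Proof.
move=> k0; have kn0 : kappa%:Z != 0 by rewrite eqz_nat -lt0n.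
split=> [[/andP[]]|[-> ->]].
  case: r => // r _ rk ->; rewrite /Phi1 /Phi2.
  have -> : q * kappa%:Z + r.+1%:Z - 1 = q * kappa%:Z + r%:Z by rewrite -addn1 PoszD; ring.
  by rewrite divzMDl// modzMDl divz_small ?addr0 ?modz_small//=; split.
rewrite /Phi1 /Phi2; have m0 := modz_ge0 (n - 1) kn0.
split.
  by rewrite /= -ltz_nat gez0_abs// ltz_pmod.
by rewrite -addn1 PoszD gez0_abs// addrA -divz_eq subrK.
Qed.

(* Main.v *)
Require Import Defs.
From HB Require Import structures.
From mathcomp Require Import all_boot all_order all_algebra.
From mathcomp Require Import complex.
From mathcomp Require Import all_classical all_reals all_analysis measurable_realfun.
From mathcomp Require Import ring lra zify.
From mathcomp Require polyrcf.

(** Write C for the composition operator. Since [C^k f = f \o iter k phi], the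
    inner product of [C^k f] with [C^k 1_z], for z a point of X, is [f z] times
    the mass of [iter k phi @^-1` [set z]]. Points have positive mass, so testing
    the defect vector of f against the indicators 1_z shows that C is an
    m-isometry if and only if it has an adjoint and, at every point z,

      sum over p of (-1)^p binom(m, p) mu (iter p phi @^-1` [set z]) = 0

    ([m_isometry_alt_diff], [m_isometry_of_points]). An adjoint exists because C
    is bounded and X is countable: it is the transfer operator, which integrates a
    function over the fibre of z and divides by the mass of z ([adjoint_exists]).

    For z on the branch i, the iterated preimages are the later points of the
    branch, and the conditions at all of them say that the masses along the
    branch solve the recurrence [alt_diff m = 0], that is, form a polynomial
    sequence of degree at most m - 1 ([alt_diff_eq0P]). For z = x r, the p-th
    preimage is one point of the circuit and the branch points reached after
    leaving the circuit at one of the [Phi1 (p + r)] passages through [x kappa]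
    ([iter_phi_eq_x]), and the condition is the displayed equation for r.

    It remains to see why the degree is at most m - 2. For an m-isometry, the
    mass [a n] of the n-th preimage of [x kappa] is also a polynomial sequence of
    degree at most m - 1. The preimage of order n + kappa contains the one of
    order n and, disjointly, the point [xb i (n + kappa)] ([measure_branch_le]).
    So the mass of this point is nonnegative and at most [a (n + kappa) - a n],
    which is polynomial of degree at most m - 2; a nonnegative polynomial
    sequence cannot have larger degree than a polynomial bound
    ([degree_drop]). *)

Set Implicit Arguments.
Unset Strict Implicit.
Unset Printing Implicit Defensive.
Import Order.TTheory GRing.Theory Num.Theory.
Local Open Scope classical_set_scope.
Local Open Scope ring_scope.

(** * Finite differences and polynomial sequences *)

Definition alt_diff (R : comNzRingType) (m : nat) (g : nat -> R) (n : nat) : R :=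
  \sum_(0 <= p < m.+1) (-1) ^+ p * 'C(m, p)%:R * g (n + p)%N.

(** Pascal's rule: up to sign, [alt_diff m] is the m-th iterate of the forward
    difference operator, which is what makes induction on m possible. *)
Lemma alt_diffS (R : comNzRingType) m (g : nat -> R) n :
  alt_diff m.+1 g n = alt_diff m (fun k => g k - g k.+1) n.
Proof.
rewrite /alt_diff big_nat_recl//=.
under eq_bigr do rewrite binS natrD mulrDr mulrDl.
rewrite big_split/= addrA.
under [in RHS]eq_bigr do rewrite mulrBr.
rewrite sumrB; congr (_ + _).
  rewrite [RHS]big_nat_recl//= [in LHS]big_nat_recr//=.
  by rewrite (bin_small (ltnSn m)) mulr0n mulr0 mul0r addr0 !bin0.
rewrite -sumrN; apply: eq_bigr => p _.
by rewrite exprS mulN1r -!mulNr addnS.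
Qed.

Lemma alt_diff_ext (R : comNzRingType) m (g h : nat -> R) n :
  (forall k, g k = h k) -> alt_diff m g n = alt_diff m h n.
Proof. by move=> gh; apply: eq_bigr => p _; rewrite gh. Qed.

Lemma size_comp_translate (R : idomainType) (p : {poly R}) c :
  size (p \Po ('X + c%:P)) = size p.
Proof. by rewrite size_comp_poly2// size_XaddC. Qed.

(** A polynomial and its translate have the same leading coefficient, so their
    difference loses one degree. *)
Lemma size_translate_sub (R : idomainType) m (p : {poly R}) c :
  (size p <= m.+1)%N -> (size (p \Po ('X + c%:P) - p)%R <= m)%N.
Proof.
move=> sp.
have lpc : lead_coef (p \Po ('X + c%:P)) = lead_coef p.
  by rewrite lead_coef_comp ?size_XaddC// lead_coefXaddC expr1n mulr1.
apply/leq_sizeP => j mj; rewrite coefB.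
have [jq|jq] := eqVneq j (size p).-1.
  by move: lpc; rewrite !lead_coefE size_comp_translate jq => ->; rewrite subrr.
have lj : (size p <= j)%N.
  have := leq_trans sp (mj : m.+1 <= j.+1)%N; rewrite leq_eqVlt => /orP[/eqP pj|//].
  by rewrite pj eqxx in jq.
by rewrite !nth_default ?size_comp_translate// subrr.
Qed.

Lemma horner_translate (R : comNzRingType) (p : {poly R}) k n :
  (p \Po ('X + k%:R%:P)).[n%:R] = p.[(n + k)%:R].
Proof. by rewrite horner_comp !hornerE natrD. Qed.

Lemma alt_diff_poly (R : idomainType) m (p : {poly R}) n :
  (size p <= m)%N -> alt_diff m (fun k => p.[k%:R]) n = 0.
Proof.
elim: m p n => [|m IH] p n sp.
  rewrite /alt_diff big_nat1; move: sp; rewrite leqn0 size_poly_eq0 => /eqP->.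
  by rewrite horner0 mulr0.
rewrite alt_diffS.
transitivity (alt_diff m (fun k => (- (p \Po ('X + 1%:R%:P) - p)).[k%:R]) n).
  by apply: alt_diff_ext => k;
    rewrite hornerN hornerD hornerN opprB horner_translate addn1.
by apply: IH; rewrite size_polyN size_translate_sub.
Qed.

Lemma poly_interpolation (R : numFieldType) m (g : nat -> R) :
  exists2 p : {poly R}, (size p <= m)%N & forall n, (n < m)%N -> p.[n%:R] = g n.
Proof.
elim: m => [|m [p sp pg]]; first by exists 0; rewrite ?size_poly0.
pose q : {poly R} := \prod_(0 <= i < m) ('X - (i%:R)%:P).
have qE n : q.[n%:R] = \prod_(i < m) (n%:R - i%:R).
  by rewrite horner_prod big_mkord; apply: eq_bigr => i _; rewrite !hornerE.
have qm : q.[m%:R] != 0.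
  rewrite qE; apply/prodf_neq0 => i _.
  by rewrite subr_eq0 eqr_nat gtn_eqF.
exists (p + ((g m - p.[m%:R]) / q.[m%:R]) *: q).
  rewrite (leq_trans (size_polyD _ _))// geq_max (leq_trans sp)//=.
  rewrite (leq_trans (size_scale_leq _ _))//.
  by rewrite size_prod_XsubC size_iota subn0.
move=> n; rewrite ltnS leq_eqVlt hornerD hornerZ => /orP[/eqP->|nm].
  by rewrite divfK// addrC subrK.
by rewrite pg// [q.[n%:R]]qE (bigD1 (Ordinal nm))//= subrr mul0r mulr0 addr0.
Qed.

(** A solution of the recurrence [alt_diff m g = 0] is determined by its first m
    values, because the coefficient of the last term is a sign; hence it
    coincides with the polynomial of degree < m that interpolates these values. *)
Lemma alt_diff_eq0P (R : numFieldType) m (g : nat -> R) :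
  (forall n, alt_diff m g n = 0) <->
  exists2 p : {poly R}, (size p <= m)%N & forall n, p.[n%:R] = g n.
Proof.
split=> [g0|[p sp pg] n]; last first.
  rewrite -(alt_diff_poly n sp).
  by apply: alt_diff_ext => k; rewrite pg.
have [p sp pg] := poly_interpolation m g.
exists p => // n; have [k] := ubnP n; elim: k n => // k IH n; rewrite ltnS => nk.
have [nm|mn] := ltnP n m; first exact: pg.
have := alt_diff_poly (n - m) sp; rewrite -(g0 (n - m)%N) /alt_diff.
rewrite !big_nat_recr//= subnK// binn mulr1.
rewrite (@eq_big_nat _ _ _ _ _ _ (fun i =>
   (-1) ^+ i * 'C(m, i)%:R * g (n - m + i)%N)); last first.
  by move=> i /andP[_ im]; rewrite IH// (leq_trans _ nk)// -ltn_subRL subKn.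
by move/addrI/mulfI; apply; rewrite signr_eq0.
Qed.

Lemma lead_coef_gt0_eventually (R : archiRealFieldType) (p : {poly R}) :
  0 < lead_coef p -> exists N, forall n, (N <= n)%N -> 0 < p.[n%:R].
Proof.
move=> lp; have [b bP] := polyrcf.poly_pinfty_gt_lc lp.
exists (Num.truncn b).+1 => n Nn; rewrite (lt_le_trans lp)// bP//.
rewrite (le_trans (ltW (truncnS_gt b)))// ler_nat//.
Qed.

(** Otherwise [p - q] has the leading coefficient of p: if this is positive then
    [p - q] is eventually positive, and if it is negative then p is eventually
    negative. *)
Lemma size_poly_dominated (R : archiRealFieldType) (p q : {poly R}) :
  (forall n, 0 <= p.[n%:R]) -> (forall n, p.[n%:R] <= q.[n%:R]) ->
  (size p <= size q)%N.
Proof.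
move=> p0 pq; rewrite leqNgt; apply/negP => sqp.
have [lp|lp|/eqP] := ltgtP 0 (lead_coef p).
- have : 0 < lead_coef (p - q) by rewrite lead_coefDl// size_polyN.
  move=> /lead_coef_gt0_eventually[N /(_ _ (leqnn N))].
  by rewrite hornerD hornerN subr_gt0 ltNge pq.
- have : 0 < lead_coef (- p) by rewrite lead_coefN oppr_gt0.
  move=> /lead_coef_gt0_eventually[N /(_ _ (leqnn N))].
  by rewrite hornerN oppr_gt0 ltNge p0.
- by rewrite eq_sym lead_coef_eq0 => /eqP p00; rewrite p00 size_poly0 in sqp.
Qed.

(** The increment [a (n + k) - a n] of a polynomial sequence has one degree less
    than a, and a nonnegative polynomial sequence below it inherits this bound.
    The offset [k.-1] is the one for which [q n] may stand for the mass of the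
    branch point of index n + 1; translations preserve the degree. *)
Lemma degree_drop (R : archiRealFieldType) m k (a q : nat -> R) :
  (forall n, alt_diff m.+1 a n = 0) -> (forall n, alt_diff m.+1 q n = 0) ->
  (forall n, 0 <= q n) -> (forall n, q (n + k.-1)%N <= a (n + k)%N - a n) ->
  exists2 p : {poly R}, (size p <= m)%N & forall n, p.[n%:R] = q n.
Proof.
move=> /alt_diff_eq0P[pa sa aE] /alt_diff_eq0P[pq _ qE] q0 qa.
exists pq => //; rewrite -(size_comp_translate pq k.-1%:R).
apply: leq_trans (size_translate_sub k%:R sa).
apply: size_poly_dominated => n; first by rewrite horner_translate qE.
by rewrite hornerD hornerN !horner_translate qE !aE.
Qed.

(** * Iterated preimages in a graph with one circuit *)

Section Circuit.
Local Open Scope nat_scope.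
Variables (X : Type) (kappa : nat) (eta : option nat).
Variables (x : nat -> X) (xb : nat -> nat -> X) (phi : X -> X).
Hypothesis hphi : one_circuit kappa eta x xb phi.

Lemma circuit_cases z :
  [\/ z = x 1, exists2 r, r.+2 <= kappa & z = x r.+2,
      exists2 i, i \in J eta & z = xb i 1 |
      exists i j, i \in J eta /\ z = xb i j.+2].
Proof.
case: (x_cover hphi z) => [[[|[|r]]//]|[i [[|[|j]] [iJ j1 ->]]]] //.
- by constructor 1.
- by move=> /andP[_ rk] ->; constructor 2; exists r.
- by constructor 3; exists i.
- by constructor 4; exists i, j.
Qed.

(** The next three lemmas list the immediate predecessors of a point: one for
    every point but [x kappa], whose predecessors are [x 1] and the first point
    of every branch. *)
Lemma phi_eq_xb z i j : i \in J eta -> 1 <= j ->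
  phi z = xb i j <-> z = xb i j.+1.
Proof.
have kJ : kappa \in J (Some kappa) by rewrite inE/= leqnn (kappa_gt0 hphi).
move=> iJ j1; split=> [|->]; last by rewrite (phi_xbS hphi).
case: (circuit_cases z) => [->|[r rk ->]|[i' i'J ->]|[i' [j' [i'J ->]]]].
- by rewrite (phi_x1 hphi) => /(x_neq_xb hphi kJ iJ j1).
- by rewrite (phi_xS hphi)// => /(x_neq_xb hphi _ iJ j1) []; rewrite inE/=; lia.
- by rewrite (phi_xb1 hphi)// => /(x_neq_xb hphi kJ iJ j1).
- by rewrite (phi_xbS hphi)// => /(xb_inj hphi i'J iJ (ltn0Sn j') j1) [-> <-].
Qed.

Lemma phi_eq_x z s : 1 <= s < kappa -> phi z = x s <-> z = x s.+1.
Proof.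
move=> sk; have sJ : s \in J (Some kappa) by rewrite inE/=; lia.
have kJ : kappa \in J (Some kappa) by rewrite inE/=; lia.
split=> [|->]; last by rewrite (phi_xS hphi).
case: (circuit_cases z) => [->|[r rk ->]|[i' i'J ->]|[i' [j' [i'J ->]]]].
- by rewrite (phi_x1 hphi) => /(x_inj hphi kJ sJ); lia.
- rewrite (phi_xS hphi)// => /(x_inj hphi _ sJ) /= <- //.
  by rewrite inE/=; lia.
- by rewrite (phi_xb1 hphi)// => /(x_inj hphi kJ sJ); lia.
- by rewrite (phi_xbS hphi)// => /esym/(x_neq_xb hphi sJ i'J (ltn0Sn j')).
Qed.

Lemma phi_eq_xkappa z :
  phi z = x kappa <-> z = x 1 \/ exists2 i, i \in J eta & z = xb i 1.
Proof.
have kJ : kappa \in J (Some kappa) by rewrite inE/= leqnn (kappa_gt0 hphi).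
split; last by case=> [->|[i iJ ->]]; [exact: phi_x1 hphi|rewrite (phi_xb1 hphi)].
case: (circuit_cases z) => [->|[r rk ->]|[i' i'J ->]|[i' [j' [i'J ->]]]].
- by left.
- rewrite (phi_xS hphi)// => /(x_inj hphi _ kJ) /= E.
  have /E : r.+1 \in J (Some kappa) by rewrite inE/=; lia.
  by lia.
- by right; exists i'.
- by rewrite (phi_xbS hphi)// => /esym/(x_neq_xb hphi kJ i'J (ltn0Sn j')).
Qed.

Lemma iter_phi_eq_xb p z i j : i \in J eta -> 1 <= j ->
  iter p phi z = xb i j <-> z = xb i (j + p).
Proof.
move=> iJ j1; elim: p z => [|p IH] z; first by rewrite addn0.
by rewrite iterSr IH phi_eq_xb ?addnS// (leq_trans j1)// leq_addr.
Qed.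

(** Walking p steps backwards from [x r] along the circuit leads to [x s], where
    s is p + r reduced to [1, kappa], after q passages through [x kappa]. At each
    passage one may leave the circuit along a branch; after the remaining steps
    one stands at a point of the branch whose index is s modulo kappa and at
    most [q * kappa]. In the induction the first step of z is split off, which
    replaces s by its predecessor in the cyclic order of [1, kappa]. *)
Lemma iter_phi_eq_x p q r s z :
  1 <= r <= kappa -> 1 <= s <= kappa -> p + r = q * kappa + s ->
  iter p phi z = x r <->
  z = x s \/ exists i l, [/\ i \in J eta, l < q & z = xb i (l * kappa + s)].
Proof.
move=> rk; elim: p q s z => [|p IH] q s z sk pq.
  (* [r = q * kappa + s] with r and s in [1, kappa] forces q to be 0. *)
  have q0 : q = 0 by case: q pq => // q; rewrite mulSn; lia.
  have -> : r = s by rewrite q0 in pq; lia.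
  by rewrite q0 /=; split=> [->|[//|[i [l []]]]//]; left.
rewrite iterSr; case: s sk pq => [//|[|s]] sk pq.
  have q0 : 0 < q by case: q pq => // q; lia.
  have k0 := kappa_gt0 hphi.
  have qS : q = q.-1.+1 by lia.
  rewrite (IH q.-1 kappa); [|lia|move: pq; rewrite qS mulSn /=; lia].
  rewrite phi_eq_xkappa; split=> [[[->|[i iJ ->]]|[i [l [iJ lq]]]]|
                                 [->|[i [[|l] [iJ lq ->]]]]].
  - by left.
  - by right; exists i, 0.
  - rewrite phi_eq_xb//; last lia.
    move=> ->; right; exists i, l.+1; split => //; first lia.
    by rewrite mulSn addn1 addnC.
  - by left; left.
  - by left; right; exists i.
  - right; exists i, l; split => //; first lia.
    by rewrite phi_eq_xb//; [rewrite mulSn addn1 addnC|lia].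
rewrite (IH q s.+1); [|lia|lia].
rewrite phi_eq_x; last lia.
by split=> [[->|[i [l [iJ lq E]]]]|[->|[i [l [iJ lq E]]]]]; [by left| |by left|];
  right; exists i, l; split => //; move: E; rewrite phi_eq_xb// ?addnS.
Qed.

Lemma circuit_countable : countable [set: X].
Proof.
pose F n j := if n is i.+1 then xb i j else x j.
have -> : [set: X] = \bigcup_(n in [set: nat]) \bigcup_(j in [set: nat]) [set F n j].
  apply/esym; rewrite -subTset => z _.
  case: (x_cover hphi z) => [[r _ ->]|[i [j [_ _ ->]]]].
    by exists 0 => //; exists r.
  by exists i.+1 => //; exists j.
apply: bigcup_countable => // n _; exact: bigcup_countable.
Qed.
End Circuit.

Section CircuitMeasure.
Variables (R : realType) (d : measure_display) (X : measurableType d).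
Variables (mu : {measure set X -> \bar R}) (hmu : pointwise_measure mu).
Variables (kappa : nat) (eta : option nat).
Variables (x : nat -> X) (xb : nat -> nat -> X) (phi : X -> X).
Hypothesis hphi : one_circuit kappa eta x xb phi.

Lemma measure_iter_preimage_x p q r s :
  (1 <= r <= kappa)%N -> (1 <= s <= kappa)%N -> (p + r = q * kappa + s)%N ->
  (mu (iter p phi @^-1` [set x r]) =
   mu [set x s] + \sum_(1 <= i <oo | i \in J eta)
     \sum_(0 <= l < q) mu [set xb i (l * kappa + s)%N])%E.
Proof.
move=> rk sk pq; have mA := hmu.1; have k0 := kappa_gt0 hphi.
pose B i := \big[setU/set0]_(l < q) [set xb i (l * kappa + s)%N].
have BE i z : B i z <-> exists2 l, (l < q)%N & z = xb i (l * kappa + s)%N.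
  rewrite /B -(bigcup_mkord q (fun l => [set xb i (l * kappa + s)%N])).
  by split=> [[l /= lq ->]|[l lq ->]]; exists l.
have s0 l : (1 <= l * kappa + s)%N by lia.
have -> : iter p phi @^-1` [set x r] =
    [set x s] `|` \bigcup_(i in [set i | i \in J eta]) B i.
  apply/seteqP; split=> z /=; rewrite (iter_phi_eq_x hphi z rk sk pq).
    move=> [->|[i [l [iJ lq ->]]]]; first by left.
    by right; exists i => //; apply/BE; exists l.
  move=> [->|[i /= iJ /BE[l lq ->]]]; first by left.
  by right; exists i, l.
have mBE : mu (\bigcup_(i in [set i | i \in J eta]) B i) =
    (\sum_(0 <= i <oo | i \in [set i | i \in J eta]) mu (B i))%E.
  apply: measure_bigcup => // i i' /= iJ i'J [z [/BE[l _ ->] /BE[l' _]]].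
  by case/(xb_inj hphi iJ i'J (s0 l) (s0 l')).
rewrite measureU//; last first.
  rewrite -subset0 => z [/= -> [i /= iJ /BE[l _]]].
  exact: (x_neq_xb hphi).
congr (_ + _)%E; rewrite [LHS]mBE.
rewrite [RHS]ereal_series_cond.
transitivity (\sum_(0 <= i <oo | (1 <= i)%N && (i \in J eta)) mu (B i))%E.
  apply: eq_eseriesl => i; rewrite mem_setE.
  by rewrite inE /= andbA andbb.
apply: eq_eseriesr => i /andP[_ iJ].
rewrite big_mkord measure_bigsetU_ord//.
move=> l l' _ _ [z [/= -> /(xb_inj hphi iJ iJ (s0 l) (s0 l'))[_ /addIn/eqP]]].
by rewrite eqn_pmul2r// => /eqP /val_inj.
Qed.

Lemma iter_preimage_xb p i j : i \in J eta -> (1 <= j)%N ->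
  iter p phi @^-1` [set xb i j] = [set xb i (j + p)%N].
Proof.
by move=> iJ j1; apply/seteqP; split=> z /=; rewrite (iter_phi_eq_xb hphi).
Qed.

(** The two sets on the left are disjoint parts of the set on the right: a point
    that reaches [x kappa] in n steps does so again after a full turn, and so
    does [xb i (n + kappa)], which only enters the circuit at that time. *)
Lemma measure_branch_le n i : i \in J eta ->
  (mu [set xb i (n + kappa)%N] + mu (iter n phi @^-1` [set x kappa]) <=
   mu (iter (n + kappa) phi @^-1` [set x kappa]))%E.
Proof.
move=> iJ; have mA := hmu.1; have k0 := kappa_gt0 hphi.
have kk : (1 <= kappa <= kappa)%N by rewrite k0 leqnn.
have E : (kappa + kappa = 1 * kappa + kappa)%N by rewrite mul1n.
rewrite -measureU//; last first.
  rewrite -subset0 => z [/= zE]; rewrite zE addnC.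
  have -> : iter n phi (xb i (kappa + n)%N) = xb i kappa.
    by apply/(iter_phi_eq_xb hphi).
  by move/esym/(x_neq_xb hphi kk iJ k0).
apply: le_measure; rewrite ?inE//.
move=> z; rewrite /= addnC iterD.
move=> H; apply/(iter_phi_eq_x hphi _ kk kk E).
case: H => [->|->]; last by left.
right; exists i, 0%N; split=> //; rewrite mul0n add0n.
by apply/(iter_phi_eq_xb hphi).
Qed.
End CircuitMeasure.

(** * Integration on a discrete measure space *)

Section DiscreteMeasure.
Variables (R : realType) (d : measure_display) (X : measurableType d).
Variables (mu : {measure set X -> \bar R}) (hmu : pointwise_measure mu).
Implicit Types (u v : X -> R) (A : set X).

Lemma discrete_measurable_fun d' (T : measurableType d') (h : X -> T) :
  measurable_fun setT h.
Proof. by move=> _ Y _; exact: hmu.1. Qed.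

Lemma integral_point (g : X -> \bar R) z :
  (\int[mu]_(t in [set z]) g t = g z * mu [set z])%E.
Proof.
rewrite -integral_cst; last exact: hmu.1.
by apply: eq_integral => t /[!inE] ->.
Qed.

Lemma Lfun2_indic A : (mu A < +oo)%E -> \1_A \in Lfun mu 2%:E.
Proof.
have mA := hmu.1 A; move=> A_fin; apply/Lfun2P; split.
  exact: discrete_measurable_fun.
rewrite (@eq_integral _ _ _ _ _ (fun z => (\1_A z)%:E)).
  by rewrite integral_indic// setIT.
by move=> z _; rewrite indicE; case: (z \in A); rewrite ?expr1n ?expr0n.
Qed.

Lemma Lfun2_mul_integrable u v : u \in Lfun mu 2%:E -> v \in Lfun mu 2%:E ->
  mu.-integrable setT (fun z => (u z * v z)%:E).
Proof. by move=> uL vL; apply/Lfun1_integrable; exact: Lfun2_mul_Lfun1. Qed.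

Lemma Lfun2_integrable_on v A : v \in Lfun mu 2%:E -> (mu A < +oo)%E ->
  mu.-integrable A (EFin \o v).
Proof.
have mA := hmu.1 A; move=> vL /Lfun2_indic AL.
apply/(integrable_mkcond _ mA).
apply: eq_integrable (Lfun2_mul_integrable vL AL) => // z _.
by rewrite patchE indicE; case: ifPn; rewrite /= ?mulr1 ?mulr0.
Qed.

(** Cauchy-Schwarz against the constant 1 on A, from the nonnegativity of the
    integral of [(v - s) ^ 2] for every s; the minimizing s is the mean of v. *)
Lemma Rintegral_sqr_le v A : v \in Lfun mu 2%:E -> (mu A < +oo)%E ->
  (\int[mu]_(t in A) v t) ^+ 2 <= fine (mu A) * \int[mu]_(t in A) (v t ^+ 2).
Proof.
move=> vL A_fin; have mA := hmu.1 A.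
have iv := Lfun2_integrable_on vL A_fin.
have iv2 : mu.-integrable A (EFin \o (fun t => v t ^+ 2)).
  apply: integrableS (Lfun2_mul_integrable vL vL) => //.
set a := fine (mu A); set I := Rintegral _ _ _; set V := Rintegral _ _ _.
have a0 : 0 <= a by rewrite fine_ge0.
have quad (s : R) : 0 <= V - s * 2 * I + s ^+ 2 * a.
  have ic : mu.-integrable A (EFin \o cst (s ^+ 2)).
    have i1 := integrableZl mA (s ^+ 2) (Lfun2_integrable_on (Lfun2_indic A_fin) A_fin).
    by apply: eq_integrable i1 => // t tA; rewrite /= indicE tA mule1.
  have is2 : mu.-integrable A (EFin \o (fun t => s * 2 * v t)).
    exact: (integrableZl mA (s * 2) iv).
  have is0 : mu.-integrable A (EFin \o (fun t => v t ^+ 2 - s * 2 * v t)).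
    exact: (integrableB mA iv2 is2).
  rewrite -[s ^+ 2 * a]Rintegral_cst// -RintegralZl// -RintegralB//.
  rewrite -RintegralD//.
  apply: Rintegral_ge0 => t _.
  rewrite [X in 0 <= X](_ : _ = (v t - s) ^+ 2) ?sqr_ge0//.
  by rewrite /cst; ring.
have [a00|an0] := eqVneq a 0.
  (* When A is null the quadratic is affine in s, so its slope must vanish:
     otherwise this s would make it equal to -1. *)
  have := quad ((V + 1) / (2 * I)); rewrite a00 mulr0 addr0 mul0r.
  have [->|I0] := eqVneq I 0; first by rewrite expr0n.
  have -> : (V + 1) / (2 * I) * 2 * I = V + 1 by field.
  lra.
have := quad (I / a).
have -> : V - I / a * 2 * I + (I / a) ^+ 2 * a = (a * V - I ^+ 2) / a by field.
by rewrite pmulr_lge0 ?subr_ge0// invr_gt0 lt_def an0.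
Qed.

Section Fibres.
Variables (code : X -> nat).

Let mcode n : d.-measurable (code @^-1` [set n]). Proof. exact: hmu.1. Qed.

Let code_cover : \bigcup_n code @^-1` [set n] = setT.
Proof. by rewrite -preimage_bigcup bigcup_imset1 image_id preimage_setT. Qed.

Let code_triv : trivIset setT (fun n => code @^-1` [set n]).
Proof. by move=> i j _ _ [z [/= -> ->]]. Qed.

Lemma ge0_integral_fibres (g : X -> \bar R) : (forall z, 0 <= g z)%E ->
  (\int[mu]_z g z = \sum_(n <oo) \int[mu]_(z in code @^-1` [set n]) g z)%E.
Proof.
move=> g0; rewrite -[in LHS]code_cover ge0_integral_bigcup//.
by rewrite code_cover; exact: discrete_measurable_fun.
Qed.

Lemma integral_fibres (g : X -> \bar R) : mu.-integrable setT g ->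
  (\int[mu]_z g z = \sum_(n <oo) \int[mu]_(z in code @^-1` [set n]) g z)%E.
Proof.
by move=> ig; rewrite -[in LHS]code_cover integral_bigcup// code_cover.
Qed.
End Fibres.
End DiscreteMeasure.

(** * The defect of a composition operator on indicators *)

Section CompositionOperator.
Variables (R : realType) (d : measure_display) (X : measurableType d).
Variables (mu : {measure set X -> \bar R}) (hmu : pointwise_measure mu).
Variables (phi : X -> X).
Hypothesis hdef : forall f : X -> R[i], f \in L2 mu -> f \o phi \in L2 mu.

Local Notation C := (comp_op hmu hdef).
Local Notation dot := (L2dot hmu).

Definition cindic (A : set X) (z : X) : R[i] := (\1_A z)%:C%C.

Lemma integral_normc_cindic A :
  (\int[mu]_z ((Normc.normc (cindic A z)) ^+ 2)%:E = mu A)%E.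
Proof.
have mA := hmu.1 A; rewrite (@eq_integral _ _ _ _ _ (fun z => (\1_A z)%:E)).
  by rewrite integral_indic// setIT.
move=> z _; rewrite normc2E /cindic/= expr0n addr0 indicE.
by case: (z \in A); rewrite ?expr1n ?expr0n.
Qed.

Lemma cindic_L2 A : cindic A \in L2 mu <-> (mu A < +oo)%E.
Proof.
rewrite -(integral_normc_cindic A) inE; split=> [[]//|lty].
by split => //; exact: (discrete_measurable_fun hmu).
Qed.

Lemma cindic_preimage (f : X -> X) A : cindic A \o f = cindic (f @^-1` A).
Proof. by apply/funext => z; rewrite /cindic /= !indicE; congr (_%:R)%:C%C;
  apply/idP/idP; rewrite !inE. Qed.

(** The indicator of [phi @^-1` A] is the image of that of A under the
    everywhere defined operator. *)
Lemma measure_preimage_lty A : (mu A < +oo)%E -> (mu (phi @^-1` A) < +oo)%E.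
Proof.
by rewrite -!cindic_L2 -cindic_preimage; exact: hdef.
Qed.

Lemma measure_iter_preimage_lty n A :
  (mu A < +oo)%E -> (mu (iter n phi @^-1` A) < +oo)%E.
Proof.
elim: n A => [//|n IH] A A_fin.
by have := IH _ (measure_preimage_lty A_fin).
Qed.

Lemma iter_comp_opE n (f : L2type hmu) : iter n C f = f \o iter n phi :> (X -> R[i]).
Proof.
elim: n => [//|n IH]; rewrite iterS.
by apply/funext => z; rewrite -[LHS]/(iter n C f (phi z)) IH /= -iterSr.
Qed.

Lemma L2dot_cindic (f g : L2type hmu) B c :
  f = cindic B :> (X -> R[i]) -> (forall z, B z -> g z = c) ->
  dot f g = (fine (mu B))%:C%C * c^*.
Proof.
have mB := hmu.1 B; move=> fE gE; rewrite /L2dot /cintegral.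
have E (a : R) : \int[mu]_z (if z \in B then a else 0) = a * fine (mu B).
  by rewrite -Rintegral_cst// [RHS]Rintegral_mkcond; apply: eq_Rintegral => z _;
    rewrite patchE.
have fgE z : f z * (g z)^* = if z \in B then c^* else 0.
  rewrite fE /cindic indicE; case: ifPn => [/set_mem/gE->|_].
    by rewrite mul1r.
  by rewrite mul0r.
rewrite (@eq_Rintegral _ _ _ _ _
  (fun z => if z \in B then complex.Re c else 0)); last first.
  by move=> z _; rewrite fgE; case: ifPn => // _; case: c {gE fgE}.
rewrite [X in Complex _ X](@eq_Rintegral _ _ _ _ _
  (fun z => if z \in B then - complex.Im c else 0)); last first.
  by move=> z _; rewrite fgE; case: ifPn => // _; case: c {gE fgE}.
rewrite !E; case: c {gE fgE} => a b /=.
by congr Complex; rewrite mul0r ?subr0 ?addr0 mulrC.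
Qed.

Lemma measure_point_lty z : (mu [set z] < +oo)%E.
Proof. by case/andP: (hmu.2 z). Qed.

Definition indicL2 A (A_fin : (mu A < +oo)%E) : L2type hmu :=
  MkL2 hmu ((cindic_L2 A).2 A_fin).

Lemma L2dot_iter_adjoint S n u v : is_adjoint dot C S ->
  dot u (iter n S v) = dot (iter n C u) v.
Proof.
move=> adj; elim: n u => [//|n IH] u; rewrite [in RHS]iterSr -IH.
exact/esym/adj.
Qed.

Definition preimage_measure A n : R := fine (mu (iter n phi @^-1` A)).

Lemma L2dot_iter_cindic A (A_fin : (mu A < +oo)%E) n (f : L2type hmu) c :
  (forall z, A z -> f z = c) ->
  dot (iter n C (indicL2 A_fin)) (iter n C f) = (preimage_measure A n)%:C%C * c^*.
Proof.
move=> fc; apply: L2dot_cindic; first by rewrite iter_comp_opE cindic_preimage.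
by move=> z Az; rewrite iter_comp_opE; exact: fc.
Qed.

(** Testing the defect operator against the indicator of a set on which f is
    constant turns the operator identity into a scalar recurrence for the
    measures of the iterated preimages of that set. *)
Lemma L2dot_defect S m A (A_fin : (mu A < +oo)%E) (f : L2type hmu) c :
  is_adjoint dot C S -> (forall z, A z -> f z = c) ->
  dot (indicL2 A_fin)
    (\sum_(0 <= k < m.+1) ((-1) ^+ k * 'C(m, k)%:R) *: iter k S (iter k C f)) =
  (alt_diff m (preimage_measure A) 0)%:C%C * c^*.
Proof.
move=> adj fc; rewrite linear_sumr/= rmorph_sum/= mulr_suml.
apply: eq_bigr => k _; rewrite linearZr/= L2dot_iter_adjoint// (L2dot_iter_cindic _ _ fc).
rewrite add0n mulrA; congr (_ * _).
by rewrite !rmorphM !rmorphXn !rmorphN1 !rmorph_nat.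
Qed.

(** The recurrence at an arbitrary n is the recurrence at 0 for the n-th
    preimage of A. *)
Lemma m_isometry_alt_diff m A n : (mu A < +oo)%E ->
  m_isometry dot m C -> alt_diff m (preimage_measure A) n = 0.
Proof.
move=> /(measure_iter_preimage_lty n) B_fin [S adj iso].
have := L2dot_defect m B_fin adj (c := 1) (f := indicL2 B_fin).
rewrite iso linear0r conjC1 mulr1 => /(_ _) H.
have /H/esym : forall z, (iter n phi @^-1` A) z -> indicL2 B_fin z = 1.
  by move=> z Az; rewrite /= /cindic indicE mem_set.
move=> [E]; rewrite -[RHS]E; apply: eq_bigr => p _.
rewrite /preimage_measure add0n; congr (_ * fine (mu _)).
by apply/funext => z /=; rewrite iterD.
Qed.

(** The defect vector of f is orthogonal to the indicator of every point, that
    is, it vanishes at every point. *)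
Lemma m_isometry_of_points m S : is_adjoint dot C S ->
  (forall z, alt_diff m (preimage_measure [set z]) 0 = 0) -> m_isometry dot m C.
Proof.
move=> adj pts; exists S => // f; set v := (X in X = 0).
apply/val_inj/funext => z /=.
have fz t : [set z] t -> f t = f z by move=> /= ->.
have vz t : [set z] t -> v t = v z by move=> /= ->.
have := L2dot_defect m (measure_point_lty z) adj fz.
rewrite pts mul0r -/v.
have -> := L2dot_iter_cindic (measure_point_lty z) 0 vz.
move/eqP; rewrite mulf_eq0 conjC_eq0 => /orP[|/eqP//].
have /andP[z0 zoo] := hmu.2 z.
by rewrite eq_complex/= eqxx andbT gt_eqF// fine_gt0// z0.
Qed.
End CompositionOperator.

(** * The adjoint of a composition operator *)

Section Adjoint.
Variables (R : realType) (d : measure_display) (X : measurableType d).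
Variables (mu : {measure set X -> \bar R}) (hmu : pointwise_measure mu).
Variables (phi : X -> X).
Hypothesis hdef : forall f : X -> R[i], f \in L2 mu -> f \o phi \in L2 mu.
Local Notation C := (comp_op hmu hdef).
Local Notation dot := (L2dot hmu).
Implicit Types (u v : X -> R) (A : set X).

Let m1 z : R := fine (mu [set z]).

Let m1_gt0 z : 0 < m1 z.
Proof. by have /andP[z0 zoo] := hmu.2 z; rewrite fine_gt0// z0. Qed.

Let m1E z : (m1 z)%:E = mu [set z].
Proof. by rewrite fineK// ge0_fin_numE//; case/andP: (hmu.2 z). Qed.

Let fibre_fin z : (mu (phi @^-1` [set z]) < +oo)%E.
Proof. by apply: (measure_preimage_lty hmu hdef); case/andP: (hmu.2 z). Qed.

(** The transfer operator of phi, which is the adjoint on real functions: pairing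
    v with the image of the indicator of z gives the integral of v over the fibre,
    and pairing with the indicator itself weighs the value at z by its mass. *)
Definition transfer v z : R :=
  (fine (mu [set z]))^-1 * \int[mu]_(t in phi @^-1` [set z]) v t.

Hypothesis Xcountable : countable [set: X].
Variable K : R.
Hypothesis hK : forall z, (mu (phi @^-1` [set z]) <= K%:E * mu [set z])%E.

Let K_ge z : fine (mu (phi @^-1` [set z])) / m1 z <= K.
Proof.
rewrite ler_pdivrMr// -lee_fin fineK ?ge0_fin_numE// EFinM m1E; exact: hK.
Qed.

Let code_fibre (code : X -> nat) n : {in setT &, injective code} ->
  code @^-1` [set n] = set0 \/ exists z, code @^-1` [set n] = [set z].
Proof.
move=> code_inj; have [->|/set0P[z /= zn]] := eqVneq (code @^-1` [set n]) set0.
  by left.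
right; exists z; apply/seteqP; split=> t /=; last by move=> ->.
by rewrite -zn => /code_inj; apply; rewrite inE.
Qed.

(** Cauchy-Schwarz on each fibre of phi, together with the bound K on the mass
    ratio of fibre and point, gives norm at most [Num.sqrt K]; the code of the
    points turns the integrals into series over the fibres. *)
Lemma transfer_Lfun2 v : v \in Lfun mu 2%:E -> transfer v \in Lfun mu 2%:E.
Proof.
move=> vL; apply/Lfun2P; split; first exact: (discrete_measurable_fun hmu).
have /Lfun2P[_ v_fin] := vL.
have [code code_inj] := countable_injP _ Xcountable.
apply: (@le_lt_trans _ _ (\sum_(n <oo) (K%:E *
    \int[mu]_(t in (code \o phi) @^-1` [set n]) (v t ^+ 2)%:E))%E).
  rewrite (ge0_integral_fibres hmu code); last by move=> z; rewrite lee_fin sqr_ge0.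
  apply: lee_nneseries => [n _ _|n _].
    by apply: integral_ge0 => z _; rewrite lee_fin sqr_ge0.
  rewrite comp_preimage; have [->|[z ->]] := code_fibre n code_inj.
    by rewrite preimage_set0 !integral_set0 mule0.
  rewrite integral_point// -m1E -EFinM.
  have ifib : mu.-integrable (phi @^-1` [set z]) (fun t => (v t ^+ 2)%:E).
    apply: integrableS (Lfun2_mul_integrable vL vL) => //; exact: hmu.1.
  have Rfib : (\int[mu]_(t in phi @^-1` [set z]) (v t ^+ 2)%:E)%E =
      (\int[mu]_(t in phi @^-1` [set z]) (v t ^+ 2))%:E.
    by rewrite fineK//; apply: integrable_fin_num => //; exact: hmu.1.
  rewrite Rfib -EFinM lee_fin.
  set V := Rintegral _ _ _.
  have V0 : 0 <= V by apply: Rintegral_ge0 => t _; exact: sqr_ge0.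
  have IV := Rintegral_sqr_le hmu vL (fibre_fin z).
  have m0 := m1_gt0 z.
  apply: le_trans (ler_wpM2r V0 (K_ge z)).
  rewrite /transfer -/(m1 z); set I := Rintegral _ _ _ in IV *.
  have -> : ((m1 z)^-1 * I) ^+ 2 * m1 z = I ^+ 2 / m1 z by field; rewrite gt_eqF.
  by rewrite [leRHS]mulrAC ler_pM2r// invr_gt0.
rewrite nneseriesZl; last first.
  by move=> n _; apply: integral_ge0 => z _; rewrite lee_fin sqr_ge0.
rewrite -(ge0_integral_fibres hmu (code \o phi)); last first.
  by move=> z; rewrite lee_fin sqr_ge0.
move: v_fin; set V := integral _ _ _ => v_fin.
have V0 : (0 <= V)%E by apply: integral_ge0 => z _; rewrite lee_fin sqr_ge0.
by rewrite -(@fineK _ V) ?ge0_fin_numE// -EFinM ltry.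
Qed.

(** [u \o phi] is constant on each fibre of phi, so both integrals have the same
    contribution from the fibre over each point. *)
Lemma transfer_adjoint u v : u \in Lfun mu 2%:E -> v \in Lfun mu 2%:E ->
  u \o phi \in Lfun mu 2%:E ->
  \int[mu]_z (u (phi z) * v z) = \int[mu]_z (u z * transfer v z).
Proof.
move=> uL vL uphiL.
have [code code_inj] := countable_injP _ Xcountable.
congr fine.
rewrite (integral_fibres hmu (code \o phi) (Lfun2_mul_integrable uphiL vL)).
rewrite (integral_fibres hmu code (Lfun2_mul_integrable uL (transfer_Lfun2 vL))).
apply: eq_eseriesr => n _.
rewrite comp_preimage; have [->|[z ->]] := code_fibre n code_inj.
  by rewrite preimage_set0 !integral_set0.
rewrite integral_point// -m1E -EFinM.
rewrite (@eq_integral _ _ _ _ _ (fun t => (u z)%:E * (v t)%:E)%E); last first.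
  by move=> t /[!inE] /= ->; rewrite EFinM.
have iv := Lfun2_integrable_on hmu vL (fibre_fin z).
have mF : d.-measurable (phi @^-1` [set z]) by exact: hmu.1.
rewrite integralZl//; have -> : (\int[mu]_(t in phi @^-1` [set z]) (v t)%:E)%E =
    (\int[mu]_(t in phi @^-1` [set z]) v t)%:E.
  by rewrite fineK//; exact: integrable_fin_num.
rewrite -EFinM /transfer -/(m1 z); congr (_%:E).
by field; rewrite gt_eqF// m1_gt0.
Qed.

End Adjoint.

Section AdjointExists.
Variables (R : realType) (d : measure_display) (X : measurableType d).
Variables (mu : {measure set X -> \bar R}) (hmu : pointwise_measure mu).
Variables (phi : X -> X).
Hypothesis hdef : forall f : X -> R[i], f \in L2 mu -> f \o phi \in L2 mu.
Local Notation C := (comp_op hmu hdef).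
Local Notation dot := (L2dot hmu).

Lemma L2dotE (f g : L2type hmu) : dot f g = Complex
  (\int[mu]_z (complex.Re (f z) * complex.Re (g z)) +
   \int[mu]_z (complex.Im (f z) * complex.Im (g z)))
  (\int[mu]_z (complex.Im (f z) * complex.Re (g z)) -
   \int[mu]_z (complex.Re (f z) * complex.Im (g z))).
Proof.
have [/L2P[fr fi] /L2P[gr gi]] := (L2valP f, L2valP g).
rewrite -RintegralD ?(Lfun2_mul_integrable fr gr) ?(Lfun2_mul_integrable fi gi)//.
rewrite -RintegralB ?(Lfun2_mul_integrable fi gr) ?(Lfun2_mul_integrable fr gi)//.
congr Complex; apply: eq_Rintegral => z _; case: (f z) (g z) => [a b] [a' b'] /=.
  by rewrite mulrN opprK.
by rewrite mulrN addrC.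
Qed.

(** Boundedness on the indicator e of z, since the squared norms of e and [C e]
    are the masses of z and of its fibre. *)
Lemma bounded_measure_preimage : bounded_operator dot C ->
  exists K : R, forall z, (mu (phi @^-1` [set z]) <= K%:E * mu [set z])%E.
Proof.
move=> [c cP]; exists (complex.Re c ^+ 2) => z.
have /andP[z0 z_fin] := hmu.2 z.
pose e := indicL2 hmu z_fin.
have dE : dot e e = (fine (mu [set z]))%:C%C.
  rewrite (@L2dot_cindic _ _ _ _ _ e e [set z] 1) ?conjC1 ?mulr1//.
  by move=> t zt; rewrite /= /cindic indicE mem_set.
have dCE : dot (C e) (C e) = (fine (mu (phi @^-1` [set z])))%:C%C.
  rewrite (@L2dot_cindic _ _ _ _ _ (C e) (C e) (phi @^-1` [set z]) 1) ?conjC1 ?mulr1//.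
  by move=> t zt; rewrite /= /cindic indicE mem_set.
have hnormE u : hnorm dot u = sqrtC (dot u u) by [].
have := cP e; rewrite !hnormE dE dCE.
set a' := fine _; set a := fine _.
have a_gt0 : 0 < a by apply: fine_gt0; rewrite z0.
have a'_ge0 : 0 <= a' by rewrite fine_ge0.
move=> le_c.
have sa_gt0 : 0 < sqrtC a%:C%C by rewrite sqrtC_gt0 ltcR.
have sa'_ge0 : 0 <= sqrtC a'%:C%C by rewrite sqrtC_ge0 lecR.
have c_ge0 : 0 <= c by rewrite -(pmulr_lge0 _ sa_gt0) (le_trans sa'_ge0).
have cE : c = (complex.Re c)%:C%C.
  by move: c_ge0; rewrite lecE => /andP[/eqP c0 _]; case: c c0 {cP le_c} => ? ? /= ->.
have fibre_fin := measure_preimage_lty hmu hdef z_fin.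
rewrite -(@fineK _ (mu [set z])) ?ge0_fin_numE//.
rewrite -(@fineK _ (mu (_ @^-1` _))) ?ge0_fin_numE//.
rewrite -/a -/a' -EFinM lee_fin.
have : sqrtC a'%:C%C ^+ 2 <= (c * sqrtC a%:C%C) ^+ 2.
  by rewrite lerXn2r// ?nnegrE// mulr_ge0// ltW.
by rewrite exprMn !sqrtCK cE -!rmorphXn -rmorphM lecR.
Qed.

Hypothesis Xcountable : countable [set: X].

Lemma adjoint_exists : bounded_operator dot C -> exists S, is_adjoint dot C S.
Proof.
move=> /bounded_measure_preimage[K hK].
pose s (g : X -> R[i]) z : R[i] :=
  Complex (transfer mu phi (fun t => complex.Re (g t)) z)
    (transfer mu phi (fun t => complex.Im (g t)) z).
have sL (g : L2type hmu) : s g \in L2 mu.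
  have /L2P[gr gi] := L2valP g.
  by apply/L2P; split; apply: (transfer_Lfun2 hmu hdef Xcountable hK).
exists (fun g => MkL2 hmu (sL g)) => f g.
have /L2P[gr gi] := L2valP g.
have /L2P[fr fi] := L2valP f.
have /L2P[cr ci] := L2valP (C f).
have adj := transfer_adjoint hmu hdef Xcountable hK.
have E1 := adj _ _ fr gr cr.
have E2 := adj _ _ fi gi ci.
have E3 := adj _ _ fi gr ci.
have E4 := adj _ _ fr gi cr.
rewrite [LHS]L2dotE [RHS]L2dotE /=.
by congr Complex; [congr (_ + _)|congr (_ - _)].
Qed.
End AdjointExists.

(** * The characterization *)

Theorem theorem2p10 (R : realType) (kappa : nat) (eta : option nat)
  (d : measure_display) (X : measurableType d)
  (mu : {measure set X -> \bar R}) (hmu : pointwise_measure mu)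
  (x : nat -> X) (xb : nat -> nat -> X) (phi : X -> X)
  (hphi : one_circuit kappa eta x xb phi)
  (m : nat) (hm : (2 <= m)%N)
  (hdef : forall f : X -> R[i], f \in L2 mu -> f \o phi \in L2 mu)
  (hbdd : bounded_operator (L2dot hmu) (comp_op hmu hdef)) :
  m_isometry (L2dot hmu) m (comp_op hmu hdef) <->
  (forall i : nat, i \in J eta ->
     polynomial_seq (m - 2) (fun j => fine (mu [set xb i j.+1]))) /\
  (forall r : nat, (1 <= r <= kappa)%N ->
     (\sum_(0 <= p < m.+1) ((-1) ^+ p * 'C(m, p)%:R)%R%:E *
        (mu [set x (Phi2 kappa (p + r)%N)] +
         \sum_(1 <= i <oo | i \in J eta)
           \sum_(0 <= l < `|Phi1 kappa (p + r)%N|%N)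
             mu [set xb i (l * kappa + Phi2 kappa (p + r)%N)%N]) = 0)%E).
Proof.
have k0 := kappa_gt0 hphi.
have pt_fin z : (mu [set z] < +oo)%E by case/andP: (hmu.2 z).
have circuitE r : (1 <= r <= kappa)%N ->
    (\sum_(0 <= p < m.+1) ((-1) ^+ p * 'C(m, p)%:R)%R%:E *
        (mu [set x (Phi2 kappa (p + r)%N)] +
         \sum_(1 <= i <oo | i \in J eta)
           \sum_(0 <= l < `|Phi1 kappa (p + r)%N|%N)
             mu [set xb i (l * kappa + Phi2 kappa (p + r)%N)%N]) =
     (alt_diff m (preimage_measure mu phi [set x r]) 0)%:E)%E.
  move=> rk; rewrite /alt_diff -sumEFin; apply: eq_bigr => p _.
  have [sk pq] := (PhiP (p + r)%N (Phi1 kappa (p + r)%N) (Phi2 kappa (p + r)%N) k0).2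
    (conj erefl erefl).
  have q_ge0 : 0 <= Phi1 kappa (p + r)%N.
    rewrite divz_ge0; last by rewrite ltz_nat.
    by rewrite subr_ge0 lez_nat; case/andP: rk => r0 _; rewrite ltn_addl.
  rewrite -(measure_iter_preimage_x hmu hphi (p := p) rk sk); last first.
    by apply/eqP; rewrite -eqz_nat [eqbRHS]PoszD PoszM gez0_abs// -pq.
  rewrite add0n [in RHS]EFinM /preimage_measure fineK ?ge0_fin_numE//.
  exact: measure_iter_preimage_lty.
have branchE i j p : i \in J eta -> (1 <= j)%N ->
    preimage_measure mu phi [set xb i j] p = fine (mu [set xb i (j + p)%N]).
  by move=> iJ j1; rewrite /preimage_measure (iter_preimage_xb hphi).
have branch_diff i j n : i \in J eta ->
    alt_diff m (preimage_measure mu phi [set xb i j.+1]) n =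
    alt_diff m (fun l => fine (mu [set xb i l.+1])) (j + n).
  by move=> iJ; apply: eq_bigr => p _; rewrite branchE// addSn addnA.
split=> [iso|[poly circ]].
  have iso0 A n : (mu A < +oo)%E -> alt_diff m (preimage_measure mu phi A) n = 0.
    by move=> A_fin; exact: (m_isometry_alt_diff n A_fin iso).
  split=> [i iJ|r rk]; last by rewrite circuitE// iso0.
  (* The recurrence along the branch only gives degree m - 1; comparison with
     the circuit removes one more. *)
  have mE : (m - 2).+2 = m by rewrite -addn2 subnK.
  apply: (@degree_drop _ (m - 2).+1 kappa (preimage_measure mu phi [set x kappa])).
  - by move=> n; rewrite mE iso0.
  - by move=> n; rewrite mE -(addn0 n) -branch_diff// iso0.
  - by move=> n; exact: fine_ge0.
  move=> n; rewrite lerBrDr -lee_fin EFinD.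
  have nk_fin l : (mu (iter l phi @^-1` [set x kappa]) < +oo)%E.
    exact: measure_iter_preimage_lty.
  rewrite !fineK ?ge0_fin_numE//.
  by rewrite -addnS prednK//; exact: (measure_branch_le hmu hphi).
have [S adj] := adjoint_exists (circuit_countable hphi) hbdd.
apply: (m_isometry_of_points adj) => z.
case: (x_cover hphi z) => [[r rk ->]|[i [[|j] [iJ j1 ->]]]] //.
  by have := circ _ rk; rewrite circuitE// => -[].
rewrite branch_diff//.
have [q sq qE] := poly _ iJ.
apply: (alt_diff_eq0P m (fun l => fine (mu [set xb i l.+1]))).2; exists q => //.
by rewrite (leq_trans sq)// -[leqRHS](subnK hm) addn2.
Qed.
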